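(* Let $\kappa,\beta>0$, let $V:\mathbb{R}^2\to\mathbb{R}$, $V=V(p,q)$, be smooth, and let $f:\mathbb{C}\to\mathbb{C}$ be given by $\mathrm{Re}\, f(p+iq)=\frac{\partial V}{\partial p}(p,q)$, $\mathrm{Im}\, f(p+iq)=\frac{\partial V}{\partial q}(p,q)$. Then the two-dimensional nonparaxial nonlinear Schrödinger equation $$\kappa u_{tt}+iu_t+\beta (u_{xx}+u_{yy})+f(u)=0,\qquad u=u(x,y,t)\in\mathbb{C},$$ has a Hamiltonian formulation: with $v=u_t$, the equation (for smooth $u$) is equivalent to $$\begin{pmatrix} u_t \\ v_t \end{pmatrix}=\mathbb{J}(\kappa)\,\delta\mathcal{H}(u,v),\qquad \mathbb{J}(\kappa)=\frac1\kappa\begin{pmatrix} 0&-1 \\ 1&\frac{i}{\kappa} \end{pmatrix},$$ where $$\mathcal{H}(u,v)=\int_{-\infty}^{\infty}\int_{-\infty}^{\infty}\left(\frac{\beta}{2}(|u_x|^2+|u_y|^2)-V(u)-\frac{\kappa}{2}|v|^2\right)dx\,dy,$$ and the matrix $\mathbb{J}(\kappa)$ is skew-adjoint.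
   Context: Write $u=p+iq$, $v=\phi+i\varphi$ with $p,q,\phi,\varphi$ real, and $V(u)=V(p,q)$. The complex variational derivative is $\delta\mathcal{H}=\left(\frac{\delta\mathcal H}{\delta u},\frac{\delta\mathcal H}{\delta v}\right)^T$ with $\frac{\delta\mathcal H}{\delta u}=\frac{\delta\mathcal H}{\delta p}+i\frac{\delta\mathcal H}{\delta q}$, $\frac{\delta\mathcal H}{\delta v}=\frac{\delta\mathcal H}{\delta\phi}+i\frac{\delta\mathcal H}{\delta\varphi}$, where for a functional with density $L$ the real variational derivatives are given by the Euler operator, e.g. $\frac{\delta\mathcal H}{\delta p}=\frac{\partial L}{\partial p}-\frac{\partial}{\partial x}\frac{\partial L}{\partial p_x}-\frac{\partial}{\partial y}\frac{\partial L}{\partial p_y}$. *)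

(* Defs.v *)
From HB Require Import structures.
From mathcomp Require Import all_boot all_order all_algebra.
From mathcomp Require Import complex.
From mathcomp Require Import all_classical all_reals all_analysis.

Set Implicit Arguments.
Unset Strict Implicit.
Unset Printing Implicit Defensive.

Import Order.TTheory GRing.Theory Num.Theory.
Import numFieldNormedType.Exports.

Local Open Scope ring_scope.
Local Open Scope complex_scope.

(* 'D_v is total, so derivability is required separately.  In finite
   dimension, continuity of all iterated directional derivatives up to
   order k is C^k. *)
Fixpoint is_Ck (R : realType) (E : normedModType R) (k : nat) (g : E -> R)
    : Prop :=
  continuous g /\
  match k with
  | 0%N => True
  | k'.+1 => forall v : E,
      (forall x, derivable g x v) /\ is_Ck k' (fun x => 'D_v g x)
  end.

Definition smooth (R : realType) (E : normedModType R) (g : E -> R) : Prop :=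
  forall k, is_Ck k g.

Definition csmooth (R : realType) (E : normedModType R) (g : E -> R[i]) : Prop :=
  smooth (fun z => complex.Re (g z)) /\ smooth (fun z => complex.Im (g z)).

(* C-valued functions of real variables are differentiated componentwise. *)
Definition cderive (R : realType) (E : normedModType R) (d : E)
    (g : E -> R[i]) (z : E) : R[i] :=
  'D_d (fun w => complex.Re (g w)) z +i* 'D_d (fun w => complex.Im (g w)) z.

(* Directions x, y in the plane R * R, and x, y, t in space-time
   R * R * R = (R * R) * R. *)
Definition ex (R : realType) : R * R := (1, 0).
Definition ey (R : realType) : R * R := (0, 1).
Definition dx (R : realType) : R * R * R := (1, 0, 0).
Definition dy (R : realType) : R * R * R := (0, 1, 0).
Definition dt (R : realType) : R * R * R := (0, 0, 1).
Arguments ex {R}. Arguments ey {R}.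
Arguments dx {R}. Arguments dy {R}. Arguments dt {R}.

(* The real fields (p, q, phi, varphi) of u = p + i q, v = phi + i varphi. *)
Definition real_fields (R : realType) (u v : R * R -> R[i]) (k : 'I_4)
    (z : R * R) : R :=
  [:: complex.Re (u z); complex.Im (u z);
      complex.Re (v z); complex.Im (v z)]`_k.

(* Row k is (value, x-derivative, y-derivative) of field k. *)
Definition jet (R : realType) (w : 'I_4 -> R * R -> R) (z : R * R)
    : 'M[R]_(4, 3) :=
  \matrix_(k, j) [:: w k z; 'D_ex (w k) z; 'D_ey (w k) z]`_j.

Definition iint (R : realType) (g : R * R -> R) : \bar R :=
  (\int[lebesgue_measure \x lebesgue_measure]_z (g z)%:E)%E.

(* A functional (u, v) |-> \iint L(jet) dx dy, carried together with its
   density L because the Euler operator acts on L and the integral need not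
   converge for all smooth fields. *)
Record functional (R : realType) := Functional {
  density : 'M[R]_(4, 3) -> R
}.

Definition functional_eval (R : realType) (F : functional R)
    (u v : R * R -> R[i]) : \bar R :=
  iint (fun z => density F (jet (real_fields u v) z)).

Coercion functional_eval : functional >-> Funclass.

(* delta_mx k j is the jet coordinate direction: j = 0 for field k itself,
   j = 1, 2 for its x- and y-derivatives. *)
Definition euler (R : realType) (F : functional R) (k : 'I_4)
    (w : 'I_4 -> R * R -> R) (z : R * R) : R :=
  'D_(delta_mx k 0) (density F) (jet w z)
  - 'D_ex (fun z' => 'D_(delta_mx k 1) (density F) (jet w z')) z
  - 'D_ey (fun z' => 'D_(delta_mx k 2) (density F) (jet w z')) z.

Definition cvec2 (C : Type) (a b : C) : 'cV[C]_2 :=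
  \col_(k < 2) (if k == 0 then a else b).

(* (dF/dp + i dF/dq, dF/dphi + i dF/dvarphi)^T *)
Definition variational (R : realType) (F : functional R)
    (u v : R * R -> R[i]) (z : R * R) : 'cV[R[i]]_2 :=
  let w := real_fields u v in
  cvec2 (euler F 0 w z +i* euler F 1 w z) (euler F 2 w z +i* euler F 3 w z).

Definition nls_hamiltonian (R : realType) (kappa beta : R) (V : R * R -> R)
    : functional R :=
  Functional (fun j : 'M[R]_(4, 3) =>
    let V_u := V (j 0 0, j 1 0) in
    let u_x := j 0 1 +i* j 1 1 in
    let u_y := j 0 2 +i* j 1 2 in
    let v := j 2 0 +i* j 3 0 in
    beta / 2 * (Normc.normc u_x ^+ 2 + Normc.normc u_y ^+ 2) - V_u
      - kappa / 2 * Normc.normc v ^+ 2).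

Definition Jmx (R : realType) (kappa : R) : 'M[R[i]]_2 :=
  (kappa^-1)%:C *: \matrix_(i < 2, j < 2)
    nth 0 (nth [::] [:: [:: 0; -1]; [:: 1; 'i / kappa%:C]] i) j.

Definition skew_adjoint (R : realType) (n : nat) (A : 'M[R[i]]_n) : Prop :=
  map_mx (@conjc R) A^T = - A.

Definition nls_equation (R : realType) (kappa beta : R) (f : R[i] -> R[i])
    (u : R * R * R -> R[i]) : Prop :=
  forall z : R * R * R,
    kappa%:C * cderive dt (cderive dt u) z + 'i * cderive dt u z
    + beta%:C * (cderive dx (cderive dx u) z + cderive dy (cderive dy u) z)
    + f (u z) = 0.

(* The variational derivative is taken on the slices at fixed t. *)
Definition hamiltonian_system (R : realType) (J : 'M[R[i]]_2)
    (H : functional R) (u v : R * R * R -> R[i]) : Prop :=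
  forall (z : R * R) (t : R),
    cvec2 (cderive dt u (z, t)) (cderive dt v (z, t))
    = J *m variational H (fun z' => u (z', t)) (fun z' => v (z', t)) z.

(* Main.v *)
Require Import Defs.
From HB Require Import structures.
From mathcomp Require Import all_boot all_order all_algebra.
From mathcomp Require Import complex.
From mathcomp Require Import all_classical all_reals all_analysis.
From mathcomp Require Import ring.
Import Order.TTheory GRing.Theory Num.Theory.
Import numFieldNormedType.Exports.
Local Open Scope ring_scope.
Local Open Scope complex_scope.

(** The variational derivative of the Hamiltonian is computed explicitly.  The
    density is quadratic in every jet coordinate except u = p + i q itself, on
    which it depends through - V(p, q); its partial derivatives are therefore
    linear or partial derivatives of - V.  The Euler operator turns the
    gradient terms into a Laplacian, and since f = V_p + i V_q one gets
      delta H = (- f(u) - beta (u_xx + u_yy), - kappa v)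
    (lemma variational_nls).  Multiplying by J(kappa), the first row of the
    system reads u_t = v, and the second reads
      kappa v_t = - f(u) - beta (u_xx + u_yy) - i v,
    which for v = u_t is the nonparaxial equation (lemma nls_systemE).

    Each partial derivative of the density, and each derivative on a slice, is
    taken along a line on which the function reduces to a simpler one (lemma
    derive_line). *)

(** * Directional derivatives *)

(** A directional derivative only sees the restriction of the function to one
    line, so functions on different spaces that agree along a line have the
    same derivative there.  This moves derivatives between the jet space and
    the plane, and between space-time and its slices at fixed time. *)
Lemma derive_line (R : realType) (E F : normedModType R) (f : E -> R)
    (g : F -> R) (a d : E) (b e : F) :
  (forall h : R, f (h *: d + a) = g (h *: e + b)) ->
  'D_d f a = 'D_e g b.
Proof.
move=> fg; have fgab : f a = g b by have := fg 0; rewrite !scale0r !add0r.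
rewrite /derive fgab.
suff -> : (fun h : R => h^-1 *: ((f \o shift a) (h *: d) - g b))
        = (fun h : R => h^-1 *: ((g \o shift b) (h *: e) - g b)) by [].
by apply/funext => h /=; rewrite fg.
Qed.

Lemma derivable_line (R : realType) (E F : normedModType R) (f : E -> R)
    (g : F -> R) (a d : E) (b e : F) :
  (forall h : R, f (h *: d + a) = g (h *: e + b)) ->
  derivable g b e -> derivable f a d.
Proof.
move=> fg; have fgab : f a = g b by have := fg 0; rewrite !scale0r !add0r.
rewrite /derivable fgab.
suff -> : (fun h : R => h^-1 *: ((f \o shift a) (h *: d) - g b))
        = (fun h : R => h^-1 *: ((g \o shift b) (h *: e) - g b)) by [].
by apply/funext => h /=; rewrite fg.
Qed.

(** The coefficient of the linear term is the derivative; this covers every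
    direction in which the Hamiltonian density is quadratic. *)
Lemma derive_quadratic (R : realType) (E : normedModType R) (f : E -> R)
    (a d : E) (b c : R) :
  (forall h : R, f (h *: d + a) = f a + h * b + h ^+ 2 * c) ->
  'D_d f a = b.
Proof.
move=> fq.
(* Along the line, f is a polynomial on R: differentiate it at 0. *)
rewrite (derive_line _ _ _ f (fun h : R => f a + h * b + h ^+ 2 * c) a d 0 1).
  have D1 : is_derive (0 : R) 1 (fun h : R => h) 1 by exact: is_derive_id.
  have D : is_derive (0 : R) 1 (fun h : R => f a + h * b + h ^+ 2 * c) b.
    apply: is_derive_eq.
    by rewrite /GRing.scale /=; ring.
  by rewrite (@derive_val _ _ _ _ _ _ _ D).
by move=> h; rewrite fq addr0 [h *: 1]mulr1.
Qed.

Lemma smooth_derive (R : realType) (E : normedModType R) (g : E -> R) (d : E) :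
  smooth g -> smooth ('D_d g).
Proof. by move=> g_smooth k; have [_ /(_ d) []] := g_smooth k.+1. Qed.

Lemma smooth_derivable (R : realType) (E : normedModType R) (g : E -> R)
    (z d : E) :
  smooth g -> derivable g z d.
Proof. by move=> g_smooth; have [_ /(_ d) []] := g_smooth 1%N. Qed.

(** * Slices of space-time at fixed time *)

Lemma slice_line (R : realType) (h t : R) (d z : R * R) :
  h *: (d, 0 : R) + (z, t) = (h *: d + z, t).
Proof. by congr pair; rewrite /= scaler0 add0r. Qed.

Lemma derive_slice (R : realType) (g : R * R * R -> R) (t : R) (d z : R * R) :
  'D_d (fun z' => g (z', t)) z = 'D_(d, 0) g (z, t).
Proof. by apply: derive_line => h; rewrite slice_line. Qed.

Lemma derivable_slice (R : realType) (g : R * R * R -> R) (t : R)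
    (d z : R * R) :
  derivable g (z, t) (d, 0) -> derivable (fun z' => g (z', t)) z d.
Proof. by apply: derivable_line => h; rewrite slice_line. Qed.

Lemma cderive_slice (R : realType) (g : R * R * R -> R[i]) (t : R)
    (d z : R * R) :
  cderive d (fun z' => g (z', t)) z = cderive (d, 0) g (z, t).
Proof.
by rewrite /cderive (derive_slice _ (fun y => complex.Re (g y)))
  (derive_slice _ (fun y => complex.Im (g y))).
Qed.

(** * Partial derivatives of the Hamiltonian density *)

Lemma normc_sqr (R : rcfType) (x : R[i]) :
  Normc.normc x ^+ 2 = complex.Re x ^+ 2 + complex.Im x ^+ 2.
Proof. by case: x => a b /=; rewrite sqr_sqrtr // addr_ge0 // sqr_ge0. Qed.

(** The Hamiltonian density with the squared moduli expanded, hence visibly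
    polynomial apart from the potential term. *)
Definition nls_density (R : realType) (kappa beta : R) (V : R * R -> R)
    (j : 'M[R]_(4, 3)) : R :=
  beta / 2 * ((j 0 1 ^+ 2 + j 1 1 ^+ 2) + (j 0 2 ^+ 2 + j 1 2 ^+ 2))
  - V (j 0 0, j 1 0) - kappa / 2 * (j 2 0 ^+ 2 + j 3 0 ^+ 2).

Lemma nls_densityE (R : realType) (kappa beta : R) (V : R * R -> R) :
  density (nls_hamiltonian kappa beta V) = nls_density _ kappa beta V.
Proof. by apply/funext => j /=; rewrite !sqr_sqrtr // ?addr_ge0 // sqr_ge0. Qed.

(** Along these two directions only the potential varies, so the quadratic
    terms can be frozen at their value at the base point. *)
Lemma nls_density_value (R : realType) (kappa beta : R) (V : R * R -> R)
    (V_smooth : smooth V) (j : 'M[R]_(4, 3)) :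
  let L := nls_density _ kappa beta V in
  'D_(delta_mx 0 0) L j = - 'D_ex V (j 0 0, j 1 0) /\
  'D_(delta_mx 1 0) L j = - 'D_ey V (j 0 0, j 1 0).
Proof.
have dV e z : derivable V z e by exact: smooth_derivable.
pose c := beta / 2 * ((j 0 1 ^+ 2 + j 1 1 ^+ 2) + (j 0 2 ^+ 2 + j 1 2 ^+ 2))
  - kappa / 2 * (j 2 0 ^+ 2 + j 3 0 ^+ 2).
have Dc e z : 'D_e (cst c - V) z = - 'D_e V z.
  by rewrite deriveB // derive_cst sub0r.
have line_x (h a b : R) : h *: ex + (a, b) = (h + a, b).
  by congr pair; rewrite /= /GRing.scale /= ?mulr1 ?mulr0 ?add0r.
have line_y (h a b : R) : h *: ey + (a, b) = (a, h + b).
  by congr pair; rewrite /= /GRing.scale /= ?mulr1 ?mulr0 ?add0r.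
move=> L; rewrite -!Dc.
by split; apply: derive_line => h; rewrite /L /nls_density !mxE /=
  !(mulr0, add0r, mulr1) ?(line_x, line_y) [LHS]addrAC.
Qed.

Lemma nls_density_grad (R : realType) (kappa beta : R) (V : R * R -> R)
    (j : 'M[R]_(4, 3)) :
  let L := nls_density _ kappa beta V in
  [/\ 'D_(delta_mx 0 1) L j = beta * j 0 1,
      'D_(delta_mx 0 2) L j = beta * j 0 2,
      'D_(delta_mx 1 1) L j = beta * j 1 1 &
      'D_(delta_mx 1 2) L j = beta * j 1 2].
Proof.
by split; apply: (@derive_quadratic _ _ _ _ _ _ (beta / 2)) => h;
  rewrite /nls_density !mxE /= !(mulr0, add0r, mulr1); field.
Qed.

Lemma nls_density_velocity (R : realType) (kappa beta : R) (V : R * R -> R)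
    (j : 'M[R]_(4, 3)) :
  let L := nls_density _ kappa beta V in
  [/\ 'D_(delta_mx 2 0) L j = - kappa * j 2 0,
      'D_(delta_mx 3 0) L j = - kappa * j 3 0,
      'D_(delta_mx 2 1) L j = 0 /\ 'D_(delta_mx 2 2) L j = 0 &
      'D_(delta_mx 3 1) L j = 0 /\ 'D_(delta_mx 3 2) L j = 0].
Proof.
split.
1,2: apply: (derive_quadratic _ _ _ _ _ _ (- (kappa / 2))) => h;
  by rewrite /nls_density !mxE /= !(mulr0, add0r, mulr1); field.
all: split; apply: (derive_quadratic _ _ _ _ _ _ 0) => h;
  by rewrite /nls_density !mxE /= !(mulr0, add0r, mulr1, addr0).
Qed.

(** * Variational derivative of the Hamiltonian *)

(** Evaluates the Euler operator from the three partial derivatives of the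
    density: the last two are differentiated again, so they are needed as
    functions of the base point. *)
Lemma euler_eq (R : realType) (F : functional R) (k : 'I_4)
    (w : 'I_4 -> R * R -> R) (z : R * R) (a : R) (b c : R * R -> R) :
  'D_(delta_mx k 0) (density F) (jet w z) = a ->
  (forall z', 'D_(delta_mx k 1) (density F) (jet w z') = b z') ->
  (forall z', 'D_(delta_mx k 2) (density F) (jet w z') = c z') ->
  euler F k w z = a - 'D_ex b z - 'D_ey c z.
Proof. by move=> Da /funext Db /funext Dc; rewrite /euler Da Db Dc. Qed.

(** The gradient terms of the density contribute the divergence of
    (beta w_x, beta w_y), that is, beta times the Laplacian.  Second order
    regularity is what lets beta out of the outer derivative. *)
Lemma euler_position (R : realType) (kappa beta : R) (V : R * R -> R)
    (V_smooth : smooth V) (w : 'I_4 -> R * R -> R) (z : R * R) :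
  (forall k : 'I_4, (k < 2)%N -> derivable ('D_ex (w k)) z ex) ->
  (forall k : 'I_4, (k < 2)%N -> derivable ('D_ey (w k)) z ey) ->
  let H := nls_hamiltonian kappa beta V in
  euler H 0 w z = - 'D_ex V (w 0 z, w 1 z)
    - beta * ('D_ex ('D_ex (w 0)) z + 'D_ey ('D_ey (w 0)) z) /\
  euler H 1 w z = - 'D_ey V (w 0 z, w 1 z)
    - beta * ('D_ex ('D_ex (w 1)) z + 'D_ey ('D_ey (w 1)) z).
Proof.
move=> wx wy H.
have Z d (k : 'I_4) : derivable ('D_d (w k)) z d ->
    'D_d (fun z' => beta * 'D_d (w k) z') z = beta * 'D_d ('D_d (w k)) z.
  by move=> ?; rewrite (_ : (fun z' => _) = beta *: 'D_d (w k)) // deriveZ.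
have jE k j z' : jet w z' k j = [:: w k z'; 'D_ex (w k) z'; 'D_ey (w k) z']`_j.
  by rewrite mxE.
have value z' := nls_density_value R kappa beta V V_smooth (jet w z').
have grad z' := nls_density_grad R kappa beta V (jet w z').
have laplacian a (k : 'I_4) : (k < 2)%N ->
    a - 'D_ex (fun z' => beta * 'D_ex (w k) z') z
      - 'D_ey (fun z' => beta * 'D_ey (w k) z') z
    = a - beta * ('D_ex ('D_ex (w k)) z + 'D_ey ('D_ey (w k)) z).
  move=> k2; rewrite (Z ex k (wx k k2)) (Z ey k (wy k k2)).
  by rewrite mulrDr opprD addrA.
split; rewrite -laplacian //; apply: euler_eq => [|z'|z'];
  rewrite nls_densityE.
- by have [-> _] := value z; rewrite !jE.
- by have [-> _ _ _] := grad z'; rewrite jE.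
- by have [_ -> _ _] := grad z'; rewrite jE.
- by have [_ ->] := value z; rewrite !jE.
- by have [_ _ -> _] := grad z'; rewrite jE.
- by have [_ _ _ ->] := grad z'; rewrite jE.
Qed.

(** The density does not involve the derivatives of the velocity: both
    divergence terms are derivatives of the zero function. *)
Lemma euler_velocity (R : realType) (kappa beta : R) (V : R * R -> R)
    (w : 'I_4 -> R * R -> R) (z : R * R) :
  let H := nls_hamiltonian kappa beta V in
  euler H 2 w z = - kappa * w 2 z /\ euler H 3 w z = - kappa * w 3 z.
Proof.
have velocity z' := nls_density_velocity R kappa beta V (jet w z').
have cst0 a : a = a - 'D_ex (cst (0 : R)) z - 'D_ey (cst (0 : R)) z.
  by rewrite !derive_cst !subr0.
split; rewrite [RHS]cst0; apply: euler_eq => [|z'|z']; rewrite nls_densityE.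
- by have [-> _ _ _] := velocity z; rewrite mxE.
- by have [_ _ [-> _] _] := velocity z'.
- by have [_ _ [_ ->] _] := velocity z'.
- by have [_ -> _ _] := velocity z; rewrite mxE.
- by have [_ _ _ [-> _]] := velocity z'.
- by have [_ _ _ [_ ->]] := velocity z'.
Qed.

(** The complex form of the variational derivative,
    (- f(u) - beta (u_xx + u_yy), - kappa v). *)
Lemma variational_nls (R : realType) (kappa beta : R) (V : R * R -> R)
    (V_smooth : smooth V) (f : R[i] -> R[i])
    (f_Re : forall p q : R, complex.Re (f (p +i* q)) = 'D_ex V (p, q))
    (f_Im : forall p q : R, complex.Im (f (p +i* q)) = 'D_ey V (p, q))
    (u v : R * R -> R[i]) (z : R * R) :
  (forall d, derivable ('D_d (fun z => complex.Re (u z))) z d) ->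
  (forall d, derivable ('D_d (fun z => complex.Im (u z))) z d) ->
  variational (nls_hamiltonian kappa beta V) u v z =
  cvec2 (- f (u z)
    - beta%:C * (cderive ex (cderive ex u) z + cderive ey (cderive ey u) z))
    (- kappa%:C * v z).
Proof.
move=> uRe uIm; rewrite /variational.
pose w := real_fields u v.
have w0 : w 0 = fun z => complex.Re (u z) by [].
have w1 : w 1 = fun z => complex.Im (u z) by [].
have w2 : w 2 = fun z => complex.Re (v z) by [].
have w3 : w 3 = fun z => complex.Im (v z) by [].
have regular d (k : 'I_4) : (k < 2)%N -> derivable ('D_d (w k)) z d.
  case: k => [[|[|//]] k4] _; [exact: uRe | exact: uIm].
have [-> ->] := euler_position R kappa beta V V_smooth w z
  (regular ex) (regular ey).
have [-> ->] := euler_velocity R kappa beta V w z.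
rewrite w0 w1 w2 w3.
have fE c : f c = 'D_ex V (complex.Re c, complex.Im c)
    +i* 'D_ey V (complex.Re c, complex.Im c).
  by case: c => p q; rewrite -f_Re -f_Im; case: (f _).
rewrite fE /cderive /=.
(* The derivatives become variables, so that ring compares them as atoms
   instead of unfolding them. *)
move: ('D_ex V _) ('D_ey V _) => Vp Vq.
move: ('D_ex ('D_ex (fun z => complex.Re (u z))) z) => pxx.
move: ('D_ey ('D_ey (fun z => complex.Re (u z))) z) => pyy.
move: ('D_ex ('D_ex (fun z => complex.Im (u z))) z) => qxx.
move: ('D_ey ('D_ey (fun z => complex.Im (u z))) z) => qyy.
case: (v z) => a b /=; congr cvec2; apply/eqP; rewrite eq_complex /=;
  by apply/andP; split; apply/eqP; ring.
Qed.

(** * Equivalence of the system with the equation *)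

Lemma Jmx_mul (R : realType) (kappa : R) (a b : R[i]) :
  Jmx kappa *m cvec2 a b =
  cvec2 (- (kappa^-1)%:C * b) ((kappa^-1)%:C * (a + 'i / kappa%:C * b)).
Proof.
apply/matrixP => i j; rewrite !mxE !big_ord_recl big_ord0 !mxE /=.
by case: i => [[|[|//]] ?] /=; ring.
Qed.

Lemma Jmx_skew_adjoint (R : realType) (kappa : R) : skew_adjoint (Jmx kappa).
Proof.
have iE : 'i / kappa%:C = 0 +i* kappa^-1 :> R[i].
  rewrite -fmorphV; apply/eqP; rewrite eq_complex /=.
  by apply/andP; split; apply/eqP; ring.
rewrite /skew_adjoint /Jmx iE; apply/matrixP => i j; rewrite !mxE.
case: i j => [[|[|//]] ?] [[|[|//]] ?] /=;
  by apply/eqP; rewrite eq_complex /=; apply/andP; split; apply/eqP; ring.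
Qed.

Lemma cvec2_eq (C : Type) (a b a' b' : C) :
  cvec2 a b = cvec2 a' b' <-> a = a' /\ b = b'.
Proof.
split=> [/matrixP E|[-> ->] //].
by have := E 0 0; have := E 1 0; rewrite !mxE.
Qed.

(** The algebra behind the theorem: the first row of the system says that v is
    the time derivative of u, and the second row, multiplied by kappa, is the
    wave equation written with that v. *)
Lemma reduce_order (F : fieldType) (k i b ut vt v f L : F) :
  k != 0 ->
  ut = - k^-1 * (- k * v) /\
    vt = k^-1 * (- f - b * L + i / k * (- k * v)) <->
  ut = v /\ k * vt + i * v + b * L + f = 0.
Proof.
move=> k0; have -> : - k^-1 * (- k * v) = v by field.
split=> -[-> E]; split=> //; first by rewrite E; field.
have -> : f = - (k * vt + i * v + b * L) by rewrite -[RHS]addr0 -E addKr.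
by field.
Qed.

(** The field v is arbitrary here: the first row of the system forces it to be
    the velocity u_t, which gives both directions of the equivalence and the
    recovery of v from u. *)
Lemma nls_systemE (R : realType) (kappa beta : R) (kappa_gt0 : 0 < kappa)
    (V : R * R -> R) (V_smooth : smooth V) (f : R[i] -> R[i])
    (f_Re : forall p q : R, complex.Re (f (p +i* q)) = 'D_ex V (p, q))
    (f_Im : forall p q : R, complex.Im (f (p +i* q)) = 'D_ey V (p, q))
    (u v : R * R * R -> R[i]) (u_smooth : csmooth u) :
  hamiltonian_system (Jmx kappa) (nls_hamiltonian kappa beta V) u v <->
  forall z, cderive dt u z = v z /\
    kappa%:C * cderive dt v z + 'i * v z
    + beta%:C * (cderive dx (cderive dx u) z + cderive dy (cderive dy u) z)
    + f (u z) = 0.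
Proof.
have [uRe uIm] := u_smooth.
have k0 : kappa%:C != 0 by rewrite eq_complex /= eqxx andbT gt_eqF.
have kV : (kappa^-1)%:C = (kappa%:C)^-1 by rewrite -fmorphV.
have slice2 d z t : cderive d (cderive d (fun z' => u (z', t))) z
    = cderive (d, 0) (cderive (d, 0) u) (z, t).
  rewrite -cderive_slice; congr (cderive d _ z).
  by apply/funext => z'; rewrite cderive_slice.
have dslice (g : R * R * R -> R) z t d : smooth g ->
    derivable ('D_d (fun z' => g (z', t))) z d.
  move=> g_smooth; rewrite (_ : 'D_d _ = fun z' => 'D_(d, 0) g (z', t)).
    apply: (derivable_slice _ ('D_(d, 0) g)).
    exact/smooth_derivable/smooth_derive.
  by apply/funext => z'; rewrite derive_slice.
have varE z t := variational_nls R kappa beta V V_smooth f f_Re f_Im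
  (fun z' => u (z', t)) (fun z' => v (z', t)) z
  (fun d => dslice _ z t d uRe) (fun d => dslice _ z t d uIm).
split=> [S [z t]|S z t].
  have := S z t; rewrite varE Jmx_mul !slice2 kV => /cvec2_eq.
  exact: (reduce_order _ _ _ _ _ _ _ _ _ k0).1.
rewrite varE Jmx_mul !slice2 kV; apply/cvec2_eq.
exact: (reduce_order _ _ _ _ _ _ _ _ _ k0).2 (S (z, t)).
Qed.

(** * The Hamiltonian formulation *)

Theorem mainTheorem2 (R : realType) (kappa beta : R)
    (kappa_gt0 : 0 < kappa) (beta_gt0 : 0 < beta)
    (V : R * R -> R) (V_smooth : smooth V)
    (f : R[i] -> R[i])
    (f_Re : forall p q : R, complex.Re (f (p +i* q)) = 'D_ex V (p, q))
    (f_Im : forall p q : R, complex.Im (f (p +i* q)) = 'D_ey V (p, q)) :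
  let H := nls_hamiltonian kappa beta V in
  [/\ forall u v : R * R -> R[i],
        H u v = iint (fun z : R * R =>
          beta / 2 * (Normc.normc (cderive ex u z) ^+ 2
                       + Normc.normc (cderive ey u z) ^+ 2)
           - V (complex.Re (u z), complex.Im (u z))
           - kappa / 2 * Normc.normc (v z) ^+ 2),
      forall u v : R * R * R -> R[i], csmooth u ->
        (forall z, v z = cderive dt u z) ->
        (nls_equation kappa beta f u
         <-> hamiltonian_system (Jmx kappa) H u v),
      forall u v : R * R * R -> R[i], csmooth u ->
        hamiltonian_system (Jmx kappa) H u v ->
        forall z, v z = cderive dt u z
    & skew_adjoint (Jmx kappa)].
Proof.
move=> H; have system u v := nls_systemE R kappa beta kappa_gt0 V V_smooth f
  f_Re f_Im u v.
split.
- move=> u v; congr iint; apply/funext => z.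
  by rewrite nls_densityE /nls_density !mxE !normc_sqr.
- move=> u v u_smooth vE; rewrite system //.
  have -> : v = cderive dt u by apply/funext.
  by split=> [E z|E z]; [split|case: (E z)].
- by move=> u v u_smooth /(system _ _ u_smooth) S z; have [-> _] := S z.
- exact: Jmx_skew_adjoint.
Qed.
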